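(* Consider a scenario with signaling directions $E$ whose parties are partitioned into $\mathrm A_1,\dots,\mathrm A_{n_{\mathsf Z}}$, $\mathrm B_1,\dots,\mathrm B_{n_{\mathsf S}}$ and $\mathrm C_1,\dots,\mathrm C_{n_{\mathsf C}}$, with $n_{\mathsf S}>0$ and $n_{\mathsf C}>0$ (and $n_{\mathsf Z}\ge0$). If $(\mathrm B_i,\mathrm C_j)\notin E$ for all $i,j$, i.e. no $\mathrm B_i$ signals to any $\mathrm C_j$, then every behavior $\vec P$ of that scenario obeys $$\left(\tau_{\mathcal{A}_1}\otimes\dots\otimes\tau_{\mathcal{A}_{n_{\mathsf Z}}}\otimes\overline{\sigma}_{\mathcal{B}_1}^{\,l_1}\otimes\dots\otimes\overline{\sigma}_{\mathcal{B}_{n_{\mathsf S}}}^{\,l_{n_{\mathsf S}}}\otimes\gamma_{\mathcal{C}_1}^{k_1|z_1}\otimes\dots\otimes\gamma_{\mathcal{C}_{n_{\mathsf C}}}^{k_{n_{\mathsf C}}|z_{n_{\mathsf C}}}\right)\vec P=0$$ for all admissible indices $l_j,k_j,z_j$, and thus $\vec P$ does not have a component in the subspace $$\mathsf{Z}_{\mathcal{A}_1}\otimes\dots\otimes\mathsf{Z}_{\mathcal{A}_{n_{\mathsf Z}}}\otimes\mathsf{S}_{\mathcal{B}_1}\otimes\dots\otimes\mathsf{S}_{\mathcal{B}_{n_{\mathsf S}}}\otimes\mathsf{C}_{\mathcal{C}_1}\otimes\dots\otimes\mathsf{C}_{\mathcal{C}_{n_{\mathsf C}}}.$$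
   Context: Each party has a cardinality $\overline{A}=(A_1,\dots,A_X)$, a finite nonempty sequence of positive integers: inputs $x\in\{1,\dots,X\}$ and, for input $x$, outputs $a\in\{1,\dots,A_x\}$. Its space is $\mathcal{A}=\mathbb{R}^{\sum_x A_x}$ with standard basis $[a|x]$ and dual standard basis $[a|x]^*$. A scenario consists of the cardinalities of its parties and a set $E$ of pairs of parties (containing all $(s,s)$); $(s,t)\in E$ means $s$ can signal to $t$. A behavior of the scenario is a normalized nonnegative element of the tensor product of the party spaces, with coordinates $P(\text{outputs}|\text{inputs})$, obeying all nonsignaling constraints: whenever two disjoint sets of parties, a source set $\{\mathrm B_1,\mathrm B_2,\dots\}$ and a target set $\{\mathrm C_1,\mathrm C_2,\dots\}$, satisfy $(\mathrm B_i,\mathrm C_j)\notin E$ for all $i,j$, then, with remaining parties $\{\mathrm A_1,\mathrm A_2,\dots\}$ and outputs $\bar a,\bar b,\bar c$ and inputs $\bar x,\bar y,\bar z$ of the three groups, $$\sum_{\bar a,\bar b}P(\bar a\bar b\bar c|\bar x\bar y\bar z)=\sum_{\bar a,\bar b}P(\bar a\bar b\bar c|\bar x\bar y'\bar z)\qquad\forall\,\bar c,\bar x,\bar y,\bar y',\bar z.$$ For a party with space $\mathcal{A}$ and cardinality $(A_1,\dots,A_X)$ define: $\vec Z_{\mathcal A}=\sum_{x}\sum_{a=1}^{A_x}\frac{1}{A_x}[a|x]$; $\vec C_{\mathcal A}^{\,i|x}=\frac{1}{A_x}([i|x]-[A_x|x])$ ($1\le x\le X$, $1\le i\le A_x-1$);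 $\vec S_{\mathcal A}^{\,k}=\sum_{a=1}^{A_k}\frac{X}{A_k}[a|k]-\vec Z_{\mathcal A}$ ($1\le k\le X-1$); $\mathsf{Z}_{\mathcal A}=\mathrm{span}(\vec Z_{\mathcal A})$, $\mathsf{C}_{\mathcal A}=\mathrm{span}\{\vec C_{\mathcal A}^{\,i|x}\}$, $\mathsf{S}_{\mathcal A}=\mathrm{span}\{\vec S_{\mathcal A}^{\,k}\}$, so that $\mathcal{A}=\mathsf{S}_{\mathcal A}\oplus\mathsf{C}_{\mathcal A}\oplus\mathsf{Z}_{\mathcal A}$; and the linear forms $\sigma_{\mathcal A}^x=\sum_{a=1}^{A_x}[a|x]^*$, $\tau_{\mathcal A}=\frac1X\sum_x\sigma_{\mathcal A}^x$, $\overline{\sigma}_{\mathcal A}^{\,k}=\frac1X(\sigma_{\mathcal A}^k-\sigma_{\mathcal A}^X)$ ($1\le k\le X-1$), $\gamma_{\mathcal A}^{i|x}=A_x[i|x]^*-\sum_{a=1}^{A_x}[a|x]^*$ ($1\le x\le X$, $1\le i\le A_x-1$). Components refer to the decomposition of the tensor product of all party spaces obtained by expanding $\bigotimes(\mathsf{S}\oplus\mathsf{C}\oplus\mathsf{Z})$. Tensor products of forms are understood with the factors in the order of the parties they act on. *)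

(* Defs.v *)
From HB Require Import structures.
From mathcomp Require Import all_boot all_order all_algebra.

Set Implicit Arguments.
Unset Strict Implicit.
Unset Printing Implicit Defensive.

Import Order.TTheory GRing.Theory Num.Theory.
Local Open Scope ring_scope.

Record cardinality := Cardinality {
  card_seq :> seq nat;
  card_seq_gt0 : (0 < size card_seq)%N && all (fun m => 0 < m)%N card_seq
}.

Section Cardinality.
Variable c : cardinality.

Definition nin : nat := size c.
Definition input : finType := 'I_nin.
Definition nout (x : input) : nat := nth 0%N c x.
(* Inputs and outputs are numbered from 0: the last ones, [last_in] and
   [last_out], stand for X and A_x, and the index ranges 1 <= k <= X - 1 and
   1 <= i <= A_x - 1 become k.+1 < nin and i.+1 < nout x. *)
Definition output (x : input) : finType := 'I_(nout x).

(* [Tagged _ a : event], with a : output x, is the pair a|x. *)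
Definition event : finType := {x : input & output x}.

Lemma nin_gt0 : (0 < nin)%N.
Proof. by case/andP: (card_seq_gt0 c). Qed.

Lemma nout_gt0 x : (0 < nout x)%N.
Proof.
by case/andP: (card_seq_gt0 c) => _ /allP; apply; apply: mem_nth.
Qed.

Lemma last_in_subproof : (nin.-1 < nin)%N.
Proof. by rewrite ltn_predL nin_gt0. Qed.

Lemma last_out_subproof x : ((nout x).-1 < nout x)%N.
Proof. by rewrite ltn_predL nout_gt0. Qed.

Definition last_in : input := Ordinal last_in_subproof.
Definition last_out x : output x := Ordinal (last_out_subproof x).
Definition ev x (a : output x) : event := Tagged output a.

End Cardinality.

Section Coordinates.
Variables (R : realFieldType) (I : finType).

Definition coords := {ffun I -> R^o}.
Definition dual := 'Hom(coords, R^o).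

Definition basis (i : I) : coords := [ffun j => (j == i)%:R].

Definition eval_at (i : I) (v : coords) : R^o := v i.

Lemma eval_at_is_linear i : linear (eval_at i).
Proof. by move=> a u v; rewrite /eval_at !ffunE. Qed.

HB.instance Definition _ i :=
  GRing.isLinear.Build R coords R^o _ (eval_at i) (eval_at_is_linear i).

Definition dual_basis (i : I) : dual := linfun (eval_at i).

End Coordinates.

Section Party.
Variables (R : realFieldType) (c : cardinality).

Definition pspace := coords R (event c).
Definition pdual := dual R (event c).

Definition vecZ : pspace :=
  \sum_(x : input c) \sum_(a : output x) (nout x)%:R^-1 *: basis R (ev a).

(* The vector C^{a|x}, for e = a|x. *)
Definition vecC (e : event c) : pspace :=
  (nout (tag e))%:R^-1 *: (basis R e - basis R (ev (last_out (tag e)))).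

Definition vecS (k : input c) : pspace :=
  \sum_(a : output k) ((nin c)%:R / (nout k)%:R) *: basis R (ev a) - vecZ.

Definition subZ : {vspace pspace} := <[vecZ]>%VS.

Definition admissibleC (e : event c) : bool := ((tagged e).+1 < nout (tag e))%N.
Definition subC : {vspace pspace} :=
  <<[seq vecC e | e <- enum (event c) & admissibleC e]>>%VS.

Definition admissibleS (k : input c) : bool := (k.+1 < nin c)%N.
Definition subS : {vspace pspace} :=
  <<[seq vecS k | k <- enum (input c) & admissibleS k]>>%VS.

Definition sigma (x : input c) : pdual := \sum_(a : output x) dual_basis R (ev a).

Definition tau : pdual := (nin c)%:R^-1 *: \sum_(x : input c) sigma x.

Definition sigma_bar (k : input c) : pdual :=
  (nin c)%:R^-1 *: (sigma k - sigma (last_in c)).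

(* The form gamma^{a|x}, for e = a|x. *)
Definition gamma (e : event c) : pdual :=
  (nout (tag e))%:R *: dual_basis R e - sigma (tag e).

End Party.

Record scenario := Scenario {
  party : finType;
  pcard : party -> cardinality;
  signals : rel party;
  signals_refl : reflexive signals
}.

Section Tensor.
Variables (R : realFieldType) (s : scenario).

Definition inputs : finType := {dffun forall p : party s, input (pcard p)}.

(* An input and an output for each party: the data "outputs|inputs". *)
Definition events : finType := {dffun forall p : party s, event (pcard p)}.

Definition inputs_of (e : events) : inputs := [ffun p => tag (e p)].

(* The tensor product of the party spaces, with coordinates
   P(outputs|inputs) in the product basis. *)
Definition tspace := coords R events.
Definition tdual := dual R events.

Definition tensor_vec (v : forall p : party s, pspace R (pcard p)) : tspace :=
  [ffun e : events => \prod_p (v p (e p) : R)].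

Definition tensor_form (f : forall p : party s, pdual R (pcard p)) : tdual :=
  \sum_(e : events) (\prod_p (f p (basis R (e p)) : R)) *: dual_basis R e.

(* The tensor product of subspaces, spanned by the products of basis vectors. *)
Definition tensor_space (U : forall p : party s, {vspace pspace R (pcard p)}) :
    {vspace tspace} :=
  <<[seq tensor_vec (fun p => tnth (vbasis (U p)) (j p))
    | j : {dffun forall p : party s, 'I_(\dim (U p))}]>>%VS.

(* The sources are S and the targets T.  The outputs of the targets are
   those of t, of which only the values on T matter; the sums range over the
   outputs of all the other parties. *)
Definition nonsignaling (P : tspace) : Prop :=
  forall S T : {set party s},
    [disjoint S & T] ->
    {in S & T, forall p q, ~~ signals p q} ->
  forall (x x' : inputs) (t : events),
    (forall p, p \notin S -> x p = x' p) ->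
    (forall p, p \in T -> tag (t p) = x p) ->
  \sum_(e : events | (inputs_of e == x) && [forall p in T, e p == t p]) (P e : R)
  = \sum_(e : events | (inputs_of e == x') && [forall p in T, e p == t p]) (P e : R).

Definition normalized (P : tspace) : Prop :=
  forall x : inputs, \sum_(e : events | inputs_of e == x) (P e : R) = 1.

Definition nonnegative (P : tspace) : Prop := forall e : events, 0 <= (P e : R).

Definition behavior (P : tspace) : Prop :=
  [/\ normalized P, nonnegative P & nonsignaling P].

End Tensor.

Inductive sector := Zsec | Ssec | Csec.

Definition ord_of_sector (r : sector) : 'I_3 :=
  match r with Zsec => inord 0 | Ssec => inord 1 | Csec => inord 2 end.
Definition sector_of_ord (i : 'I_3) : sector :=
  match val i with 0 => Zsec | 1 => Ssec | _ => Csec end.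
Lemma ord_of_sectorK : cancel ord_of_sector sector_of_ord.
Proof. by case; rewrite /sector_of_ord /ord_of_sector /= inordK. Qed.

HB.instance Definition _ := Equality.copy sector (can_type ord_of_sectorK).
HB.instance Definition _ := Choice.copy sector (can_type ord_of_sectorK).
HB.instance Definition _ := Countable.copy sector (can_type ord_of_sectorK).
HB.instance Definition _ := Finite.copy sector (can_type ord_of_sectorK).

Definition sub_of (R : realFieldType) (r : sector) (c : cardinality) :
    {vspace pspace R c} :=
  match r with Zsec => subZ R c | Ssec => subS R c | Csec => subC R c end.

Section Component.
Variables (R : realFieldType) (s : scenario).
Implicit Type r : {ffun party s -> sector}.

Definition tsub r : {vspace tspace R s} :=
  tensor_space (fun p => sub_of R (r p) (pcard p)).

(* The sum of the subspaces [tsub r] is direct and is the whole space, so that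
   [component r] is the projection onto [tsub r] along all the others. *)
Definition component r (P : tspace R s) : tspace R s :=
  sumv_pi (\sum_(r' : {ffun party s -> sector}) tsub r')%VS r P.

End Component.

(* Main.v *)
(* Give every party its three projections onto Z, S and C.  The component of P
   in a sector is the tensor product of the corresponding projections applied
   to P, so each of its coordinates, like the values of the forms of the
   theorem, is a sum over events of P weighted by a product of one-party
   weights.  The weights of the Z- and S-parties depend only on their inputs,
   and those of an S-party sum to zero over its inputs.  By nonsignaling from a
   single S-party b to the set of all C-parties, the sum over outputs does not
   depend on the input of b, so the whole sum vanishes. *)
Require Import Defs.
From HB Require Import structures.
From mathcomp Require Import all_boot all_order all_algebra.

Import Order.TTheory GRing.Theory Num.Theory.
Local Open Scope ring_scope.

(** * Distributivity over dependent families, and extension by linearity *)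

(** Dependent functions biject with [fprod T]; over the tagged union of the [T i] this becomes the
    distributivity of [bigA_distr_big_dep]. *)
Lemma bigA_distr_dffun (R : comNzRingType) (I : finType) (T : I -> finType)
    (F : forall i, T i -> R) :
  \prod_i \sum_(t : T i) F i t
    = \sum_(f : {dffun forall i, T i}) \prod_i F i (f i).
Proof.
rewrite (reindex (@dffun_of_fprod I T)); last exact/onW_bij/dffun_of_fprod_bij.
transitivity (\sum_(f : fprod T) \prod_(i in I) [ffun t => F i t] (f i)).
  rewrite big_fprod; transitivity (\prod_i \sum_(u in tagged_with T i)
    untag 0 [ffun t => F i t] u); last exact: bigA_distr_big_dep.
  apply: eq_bigr => i _; rewrite [LHS]big_tag; apply: eq_bigr => u.
  by rewrite inE => /eqP ui; rewrite !untagE ffunE.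
by apply: eq_bigr => f _; apply: eq_bigr => i _; rewrite !ffunE.
Qed.

Arguments bigA_distr_dffun {R I T}.

(** The vectors satisfying the equation form the kernel of [h], a subspace, so checking generators
    suffices. The boolean treats acting as the identity and vanishing at once. *)
Lemma linear_if_span (F : fieldType) (V : vectType F) (f : {linear V -> V})
    (b : bool) (X : seq V) :
  (forall u, u \in X -> f u = if b then u else 0) ->
  forall v, v \in <<X>>%VS -> f v = if b then v else 0.
Proof.
pose h := (linfun f - b%:R *: \1)%VF.
have hE u : (u \in lker h) = (f u == if b then u else 0).
  by rewrite memv_ker !lfun_simp subr_eq0 /=; case: b {h};
    rewrite ?scale1r ?scale0r.
move=> hX v vX; apply/eqP; rewrite -hE; apply: subvP vX.
by apply/span_subvP => u /hX /eqP; rewrite hE.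
Qed.

(** * Coordinates and the dual basis *)

Section Coordinates.
Variables (R : realFieldType) (I : finType).
Implicit Types (i : I) (v : coords R I).

Lemma dual_basisE i v : dual_basis R i v = v i.
Proof. by rewrite lfunE. Qed.

Lemma coords_basis v : v = \sum_i v i *: basis R i.
Proof.
apply/ffunP => j; rewrite sum_ffunE (bigD1 j) //= !ffunE eqxx.
rewrite [_ *: _]mulr1 big1 ?addr0 // => i ij.
by rewrite !ffunE eq_sym (negPf ij) [_ *: _]mulr0.
Qed.

End Coordinates.

(** * One party: values of the forms on the vectors Z, S, C, and the three projections *)

Section Party.
Variables (R : realFieldType) (c : cardinality).
Implicit Types (v : pspace R c) (x k : input c) (e : event c).

Lemma nin_neq0 : (nin c)%:R != 0 :> R.
Proof. by rewrite pnatr_eq0 -lt0n nin_gt0. Qed.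

Lemma nout_neq0 x : (nout x)%:R != 0 :> R.
Proof. by rewrite pnatr_eq0 -lt0n nout_gt0. Qed.

Lemma big_output (V : nmodType) (F : event c -> V) x :
  \sum_(a : output x) F (ev a) = \sum_(e : event c | tag e == x) F e.
Proof.
transitivity (\sum_(y | y == x) \sum_(a : output y) F (ev a)).
  by rewrite big_pred1_eq.
rewrite (sig_big_dep (pred1 x) (fun _ => xpredT) (fun y a => F (ev a))).
by apply: eq_big => [e|[y a] _]; rewrite ?andbT.
Qed.

Lemma sigmaE x v : sigma R x v = \sum_(e : event c | tag e == x) v e.
Proof.
rewrite sum_lfunE -big_output; apply: eq_bigr => a _; exact: dual_basisE.
Qed.

Lemma tauE v : tau R c v = (nin c)%:R^-1 * \sum_x sigma R x v.
Proof. by rewrite scale_lfunE sum_lfunE. Qed.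

Lemma sigma_barE k v :
  sigma_bar R k v = (nin c)%:R^-1 * (sigma R k v - sigma R (last_in c) v).
Proof. by rewrite scale_lfunE add_lfunE opp_lfunE. Qed.

Lemma sigma_basis x e : sigma R x (basis R e) = (tag e == x)%:R.
Proof.
rewrite sigmaE big_mkcond (bigD1 e) //= ffunE eqxx big1 ?addr0 => [|f fe].
  by case: (tag e == x).
by rewrite ffunE (negPf fe) if_same.
Qed.

Lemma sum_input_delta x : \sum_y (x == y)%:R = 1 :> R.
Proof.
by rewrite (bigD1 x) //= eqxx big1 ?addr0 // => y /negPf; rewrite eq_sym => ->.
Qed.

Lemma tau_basis e : tau R c (basis R e) = (nin c)%:R^-1.
Proof.
rewrite tauE; under eq_bigr do rewrite sigma_basis.
by rewrite sum_input_delta mulr1.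
Qed.

Lemma vecZE e : vecZ R c e = (nout (tag e))%:R^-1.
Proof.
rewrite /vecZ (sig_big_dep xpredT (fun _ => xpredT)
  (fun x a => (nout x)%:R^-1 *: basis R (ev a))) /=.
(* The expected coordinate function is expanded in the basis, which reproduces the sum defining
   [vecZ]. *)
have := coords_basis R _ [ffun f : event c => (nout (tag f))%:R^-1 : R^o].
move/ffunP/(_ e); rewrite ffunE => ->; congr (fun_of_fin _ e).
by apply: eq_bigr => -[x a] _; rewrite ffunE.
Qed.

Lemma vecSE k e :
  vecS R k e = ((nin c)%:R * (tag e == k)%:R - 1) / (nout (tag e))%:R.
Proof.
rewrite ffunE [(- vecZ R c) e]ffunE vecZE mulrBl mul1r; congr (_ - _).
rewrite (big_output _ (fun f => (_ / (nout k)%:R : R) *: basis R f)).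
rewrite sum_ffunE big_mkcond (bigD1 e) //= big1 ?addr0 => [|f fe].
  case: eqP => [<-|_]; last by rewrite mulr0 mul0r.
  by rewrite !ffunE eqxx [_ *: _]mulr1 mulr1.
by rewrite !ffunE [e == f]eq_sym (negPf fe) [_ *: _]mulr0 if_same.
Qed.

Lemma vecCE e f :
  vecC R e f
    = (nout (tag e))%:R^-1 * ((f == e)%:R - (f == ev (last_out (tag e)))%:R).
Proof. by rewrite !ffunE. Qed.

Lemma sum_const_output x (z : R) :
  \sum_(e : event c | tag e == x) z = (nout x)%:R * z.
Proof.
by rewrite -(big_output _ (fun=> z)) sumr_const card_ord mulr_natl.
Qed.

Lemma sigma_vecZ x : sigma R x (vecZ R c) = 1.
Proof.
rewrite sigmaE; under eq_bigr => e /eqP ex do rewrite vecZE ex.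
by rewrite sum_const_output divff ?nout_neq0.
Qed.

Lemma sigma_vecS x k : sigma R x (vecS R k) = (nin c)%:R * (x == k)%:R - 1.
Proof.
rewrite sigmaE; under eq_bigr => e /eqP ex do rewrite vecSE ex.
by rewrite sum_const_output mulrC divfK ?nout_neq0.
Qed.

Lemma sigma_vecC x e : sigma R x (vecC R e) = 0.
Proof. by rewrite /vecC linearZ linearB /= !sigma_basis /= subrr scaler0. Qed.

Lemma tau_vecZ : tau R c (vecZ R c) = 1.
Proof.
rewrite tauE; under eq_bigr do rewrite sigma_vecZ.
by rewrite sumr_const card_ord mulVf ?nin_neq0.
Qed.

Lemma tau_vecS k : tau R c (vecS R k) = 0.
Proof.
rewrite tauE; under eq_bigr do rewrite sigma_vecS eq_sym.
rewrite sumrB -mulr_sumr sum_input_delta sumr_const card_ord mulr1.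
by rewrite subrr mulr0.
Qed.

Lemma tau_vecC e : tau R c (vecC R e) = 0.
Proof. by rewrite tauE big1 ?mulr0 // => x _; apply: sigma_vecC. Qed.

(* The three closed formulas agree with tau v *: Z, the sum of the
   sigma_bar k v *: S^k, and the sum of the gamma e v *: C^e. *)
Definition sector_proj (r : sector) v : pspace R c :=
  [ffun e => let A := (nout (tag e))%:R in
     match r with
     | Zsec => tau R c v / A
     | Ssec => (sigma R (tag e) v - tau R c v) / A
     | Csec => v e - sigma R (tag e) v / A
     end : R^o].

Lemma sector_proj_is_linear r : linear (sector_proj r).
Proof.
have linD (f : pdual R c) a u v : f (a *: u + v) = a * f u + f v :> R.
  by rewrite linearP.
move=> a u v; apply/ffunP => e; rewrite !ffunE /=; case: r; rewrite ?linD.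
- by rewrite mulrDl -mulrA.
- rewrite -[_ *: (_ / _)]/(_ * (_ / _)) mulrA -mulrDl.
  by rewrite mulrBr opprD addrACA.
- rewrite -[_ *: (u e - _)]/(_ * _) mulrDl -mulrA.
  by rewrite opprD addrACA mulrBr.
Qed.

HB.instance Definition _ r :=
  GRing.isLinear.Build R (pspace R c) (pspace R c) _ (sector_proj r)
    (sector_proj_is_linear r).

Lemma sum_sector (V : nmodType) (F : sector -> V) :
  \sum_r F r = F Zsec + F Ssec + F Csec.
Proof.
rewrite (bigD1 Zsec) //= (bigD1 Ssec) /=; last by apply/eqP.
rewrite (bigD1 Csec) /=; last by apply/andP; split; apply/eqP.
by rewrite big1 ?addr0 ?addrA // => -[]; rewrite eqxx ?andbF.
Qed.

Lemma sum_sector_proj v : \sum_r sector_proj r v = v.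
Proof.
apply/ffunP => e; rewrite sum_ffunE sum_sector !ffunE /=.
by rewrite -mulrDl addrC [_ + (_ - _)]addrC !subrK.
Qed.

Lemma memv_sector_proj r v : sector_proj r v \in sub_of R r c.
Proof.
case: r => /=.
- suff ->: sector_proj Zsec v = tau R c v *: vecZ R c.
    exact/memvZ/memv_line.
  by apply/ffunP => e; rewrite !ffunE vecZE.
- suff ->: sector_proj Ssec v = \sum_k sigma_bar R k v *: vecS R k.
    (* The sum includes the last input, which is not admissible; its coefficient is zero. *)
    apply: memv_suml => k _; have [->|kX] := eqVneq k (last_in c).
      by rewrite sigma_barE subrr mulr0 scale0r mem0v.
    apply/memvZ/memv_span/map_f; rewrite mem_filter mem_enum andbT.
    rewrite /admissibleS ltn_neqAle ltn_ord andbT.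
    apply: contraNneq kX => kX; apply/eqP/val_inj.
    exact: (congr1 predn kX).
  apply/ffunP => e; rewrite sum_ffunE ffunE /=.
  pose d k := sigma R k v - sigma R (last_in c) v.
  transitivity ((\sum_k (tag e == k)%:R * d k - (nin c)%:R^-1 * \sum_k d k)
      / (nout (tag e))%:R); last first.
    rewrite mulr_sumr -sumrB mulr_suml; apply: eq_bigr => k _.
    rewrite ffunE vecSE sigma_barE -[_ *: _]/(_ * _) mulrA; congr (_ / _).
    rewrite -/(d k) [RHS]mulrBr mulr1; congr (_ - _).
    by rewrite mulrACA mulVf ?nin_neq0 // mul1r mulrC.
  congr (_ / _); rewrite (bigD1 (tag e)) //= eqxx mul1r big1 ?addr0; last first.
    by move=> k /negPf ek; rewrite eq_sym ek mul0r.
  (* The value of [sigma] at the last input is a constant shift: it cancels between [d] and the mean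
     of [d], leaving [sigma] minus [tau]. *)
  rewrite sumrB sumr_const card_ord mulrBr -tauE.
  rewrite -[sigma R _ v *+ _]mulr_natl mulKf ?nin_neq0 //.
  by rewrite /d opprB addrA subrK.
- set w := sector_proj Csec v.
  have w0 x : \sum_(e : event c | tag e == x) w e = 0.
    under eq_bigr => e /eqP ex do rewrite ffunE ex /=.
    by rewrite sumrB sum_const_output -sigmaE mulrC divfK ?nout_neq0 // subrr.
  suff ->: w = \sum_e ((nout (tag e))%:R * w e) *: vecC R e.
    (* At a last output, which is not admissible, the vector C itself is zero. *)
    apply: memv_suml => e _; have [el|el] := eqVneq e (ev (last_out (tag e))).
      by rewrite /vecC -el subrr scaler0 scaler0 mem0v.
    apply/memvZ/memv_span/map_f; rewrite mem_filter mem_enum andbT.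
    rewrite /admissibleC ltn_neqAle ltn_ord andbT.
    apply: contraNneq el => ae; case: e ae => x a /= ae.
    by apply/eqP; congr Tagged; apply/val_inj; apply: (congr1 predn ae).
  apply/ffunP => f; rewrite sum_ffunE.
  (* The subtracted term is zero by [w0]; distributed over events, it supplies the last-output part
     of each C vector. *)
  transitivity (\sum_e (f == e)%:R * w e
      - (f == ev (last_out (tag f)))%:R
        * \sum_(e : event c | tag e == tag f) w e).
    rewrite w0 mulr0 subr0 (bigD1 f) //= eqxx mul1r big1 ?addr0 // => e.
    by rewrite eq_sym => /negPf ->; rewrite mul0r.
  rewrite mulr_sumr [X in _ - X]big_mkcond -sumrB; apply: eq_bigr => e _ /=.
  rewrite [RHS]ffunE vecCE -[_ *: _]/(_ * _) mulrACA divff ?nout_neq0 //.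
  rewrite mul1r mulrBr mulrC; congr (_ - _).
  case: eqP => [->|ef]; first by rewrite mulrC.
  have [fe|_] := eqVneq f (ev (last_out (tag e))); last by rewrite mulr0.
  by case: ef; rewrite fe.
Qed.

(** By linearity only the generators matter, and on them the values of [sigma] and [tau] decide. *)
Lemma sector_proj_sub r r' v :
  v \in sub_of R r' c -> sector_proj r v = if r == r' then v else 0.
Proof.
case: r'; rewrite /= /subZ -?span_seq1; apply: linear_if_span => u.
- rewrite inE => /eqP ->; apply/ffunP => e.
  case: eqP; case: r => // _; rewrite !ffunE /=.
  + by rewrite tau_vecZ vecZE mul1r.
  + by rewrite tau_vecZ sigma_vecZ subrr mul0r.
  + by rewrite sigma_vecZ vecZE mul1r subrr.
- case/mapP => k _ ->; apply/ffunP => e.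
  case: eqP; case: r => // _; rewrite [LHS]ffunE /=.
  + by rewrite tau_vecS subr0 sigma_vecS vecSE.
  + by rewrite tau_vecS mul0r ffunE.
  + by rewrite sigma_vecS vecSE subrr ffunE.
- case/mapP => k _ ->; apply/ffunP => e.
  case: eqP; case: r => // _; rewrite [LHS]ffunE /=.
  + by rewrite sigma_vecC mul0r subr0.
  + by rewrite tau_vecC mul0r ffunE.
  + by rewrite tau_vecC sigma_vecC subrr mul0r ffunE.
Qed.

End Party.

Arguments sector_proj {R c}.

(** * Tensor products of the projections, and their identification with [component] *)

Section Tensor.
Variables (R : realFieldType) (s : scenario).
Implicit Types (e : events s) (x : inputs s) (r : {ffun party s -> sector}).

Lemma tensor_formE (f : forall p : party s, pdual R (pcard p))
    (u : tspace R s) :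
  tensor_form f u
    = \sum_(e : events s) (\prod_p (f p (basis R (e p)) : R)) * u e.
Proof.
by rewrite sum_lfunE; apply: eq_bigr => e _; rewrite scale_lfunE dual_basisE.
Qed.

(** Each factor is expanded in the basis of its subspace, and the product of these sums is
    distributed. *)
Lemma tensor_vec_mem (U : forall p : party s, {vspace pspace R (pcard p)}) v :
  (forall p, v p \in U p) -> tensor_vec v \in tensor_space U.
Proof.
move=> vU; pose j p (i : 'I_(\dim (U p))) : R := coord (vbasis (U p)) i (v p).
suff -> : tensor_vec v = \sum_(i : {dffun forall p, 'I_(\dim (U p))})
    (\prod_p j p (i p)) *: tensor_vec (fun p => tnth (vbasis (U p)) (i p)).
  apply: memv_suml => i _; apply/memvZ/memv_span.
  exact: image_f.
apply/ffunP => e; rewrite sum_ffunE ffunE.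
transitivity (\prod_p \sum_i (j p i * tnth (vbasis (U p)) i (e p) : R)).
  apply: eq_bigr => p _; rewrite [v p in LHS](coord_vbasis (vU p)) sum_ffunE.
  by apply: eq_bigr => i _; rewrite ffunE -tnth_nth.
rewrite bigA_distr_dffun; apply: eq_bigr => i _.
by rewrite !ffunE big_split.
Qed.

Definition tensor_proj r (u : tspace R s) : tspace R s :=
  \sum_(e : events s)
    u e *: tensor_vec (fun p => sector_proj (r p) (basis R (e p))).

Lemma tensor_proj_is_linear r : linear (tensor_proj r).
Proof.
move=> a u v; rewrite scaler_sumr -big_split; apply: eq_bigr => e _.
by rewrite !ffunE scalerDl scalerA.
Qed.

HB.instance Definition _ r :=
  GRing.isLinear.Build R (tspace R s) (tspace R s) _ (tensor_proj r)
    (tensor_proj_is_linear r).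

Lemma tensor_projE r (u : tspace R s) e :
  tensor_proj r u e
    = \sum_(e' : events s)
        (\prod_p (sector_proj (r p) (basis R (e' p)) (e p) : R)) * u e'.
Proof.
by rewrite sum_ffunE; apply: eq_bigr => e' _; rewrite !ffunE [_ *: _]mulrC.
Qed.

Lemma tensor_proj_vec r v :
  tensor_proj r (tensor_vec v) = tensor_vec (fun p => sector_proj (r p) (v p)).
Proof.
apply/ffunP => e; rewrite tensor_projE [RHS]ffunE.
transitivity (\sum_(e' : events s) \prod_p
    ((sector_proj (r p) (basis R (e' p)) (e p) : R) * v p (e' p))).
  by apply: eq_bigr => e' _; rewrite big_split [tensor_vec v e']ffunE.
rewrite -(bigA_distr_dffun (fun p t =>
  (sector_proj (r p) (basis R t) (e p) : R) * v p t)).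
apply: eq_bigr => p _; rewrite [v p in RHS]coords_basis linear_sum sum_ffunE.
by apply: eq_bigr => t _; rewrite linearZ [RHS]ffunE [RHS]mulrC.
Qed.

Lemma memv_tensor_proj r u : tensor_proj r u \in tsub R r.
Proof.
apply: memv_suml => e _; apply/memvZ/tensor_vec_mem => p.
exact: memv_sector_proj.
Qed.

Lemma tensor_vec_eq0 p (v : forall p : party s, pspace R (pcard p)) :
  v p = 0 -> tensor_vec v = 0.
Proof.
by move=> vp; apply/ffunP => e; rewrite !ffunE (bigD1 p) //= vp ffunE mul0r.
Qed.

(** On each party the three projections sum to the identity; distributing the product of these sums
    gives one term per assignment of sectors. *)
Lemma sum_tensor_proj u : \sum_r tensor_proj r u = u.
Proof.
rewrite exchange_big /= [RHS]coords_basis; apply: eq_bigr => e _.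
rewrite -scaler_sumr; congr (_ *: _); apply/ffunP => e'; rewrite sum_ffunE.
under eq_bigr do rewrite ffunE.
rewrite -(bigA_distr_bigA (fun p t => sector_proj t (basis R (e p)) (e' p))).
under eq_bigr => p _ do rewrite -sum_ffunE sum_sector_proj ffunE.
rewrite ffunE; have [->|ee'] := eqVneq e' e.
  by apply: big1 => p _; rewrite eqxx.
have [p ep] : exists p, e' p != e p.
  apply/existsP; rewrite -negb_forall; apply: contra ee' => /forallP ee'.
  by apply/eqP/ffunP => p; apply/eqP.
by rewrite (bigD1 p) //= (negPf ep) mul0r.
Qed.

(** Distinct assignments differ at some party, whose projection kills that factor and hence the
    product. *)
Lemma tensor_proj_tsub r r' u :
  u \in tsub R r' -> tensor_proj r u = if r == r' then u else 0.
Proof.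
apply: linear_if_span => _ /mapP[j _ ->]; rewrite [LHS]tensor_proj_vec.
have jE p : sector_proj (r p) (tnth (vbasis (sub_of R (r' p) (pcard p))) (j p))
    = if r p == r' p then tnth (vbasis (sub_of R (r' p) (pcard p))) (j p)
      else 0.
  by apply: sector_proj_sub; apply/vbasis_mem/mem_tnth.
have [rr'|rr'] := eqVneq r r'.
  by apply/ffunP => e; rewrite !ffunE; apply: eq_bigr => p _;
    rewrite jE rr' eqxx.
have [p rp] : exists p, r p != r' p.
  apply/existsP; rewrite -negb_forall; apply: contra rr' => /forallP rr'.
  by apply/eqP/ffunP => p; apply/eqP.
by apply: (@tensor_vec_eq0 p); rewrite jE (negPf rp).
Qed.

(** The components of [u] lie in their sectors and sum to [u]; applying [tensor_proj r] to that sum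
    keeps the one of [r] and kills the others. *)
Lemma component_tensor_proj r u : component r u = tensor_proj r u.
Proof.
have uV : u \in (\sum_(r' : {ffun party s -> sector}) tsub R r')%VS.
  by rewrite -[u]sum_tensor_proj; apply: memv_sumr => r' _;
    apply: memv_tensor_proj.
have cu r' : component r' u \in tsub R r' by apply: memv_sum_pi.
have {uV} su : \sum_r' component r' u = u by apply: sumv_pi_sum uV.
rewrite -[u in RHS]su linear_sum (bigD1 r) //= (tensor_proj_tsub r _ _ (cu r)).
rewrite eqxx big1 ?addr0 // => r' /negPf r'r.
by rewrite (tensor_proj_tsub r _ _ (cu r')) eq_sym r'r.
Qed.

End Tensor.

(** * Vanishing of weighted sums by nonsignaling *)

Section Nonsignaling.
Variables (R : realFieldType) (s : scenario) (P : tspace R s).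
Implicit Types (x : inputs s) (T : {set party s}).

(** An arbitrary filler outside [T], so that each assignment of events on [T] has exactly one
    representative. *)
Definition default_event (c : cardinality) : event c :=
  ev (last_out (last_in c)).

(** Events are grouped by their restriction to [T], on which the weight depends; the inner sums are
    then those compared by [nonsignaling]. *)
Lemma sum_by_target T (f : forall p : party s, event (pcard p) -> R) x :
  \sum_(e : events s | inputs_of e == x) (\prod_(p in T) f p (e p)) * P e
  = \sum_(t : events s |
        [forall p, if p \in T then tag (t p) == x p
                   else t p == default_event (pcard p)])
      (\prod_(p in T) f p (t p))
      * \sum_(e : events s |
          (inputs_of e == x) && [forall p in T, e p == t p]) P e.
Proof.
pose k (e : events s) : events s :=
  [ffun p => if p \in T then e p else default_event (pcard p)].
rewrite (partition_big k (fun t : events s => [forall p,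
    if p \in T then tag (t p) == x p else t p == default_event (pcard p)])) /=.
  apply: eq_bigr => t /forallP tP; rewrite mulr_sumr; apply: eq_big => [e|e].
    congr (_ && _); apply/eqP/forall_inP => [<- p pT | et].
      by rewrite ffunE pT.
    apply/ffunP => p; rewrite ffunE; have := tP p.
    by case: ifP => [/et/eqP//|_ /eqP ->].
  move=> /andP[_ /eqP <-]; congr (_ * _); apply: eq_bigr => p pT.
  by rewrite ffunE pT.
move=> e /eqP <-; apply/forallP => p.
by case: ifP => pT; rewrite !ffunE pT.
Qed.

(** Common core of both conclusions of the theorem: [T] will be the set of C-parties and [b] an
    S-party. *)
Lemma nonsignaling_sum_eq0 (b : party s) T
    (f : forall p : party s, event (pcard p) -> R)
    (w : forall p : party s, input (pcard p) -> R) :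
  nonsignaling P -> b \notin T -> {in T, forall q, ~~ signals b q} ->
  (forall p, p \notin T -> forall t, f p t = w p (tag t)) ->
  \sum_x w b x = 0 ->
  \sum_(e : events s) (\prod_p f p (e p)) * P e = 0.
Proof.
move=> nsP bT bq fw wb.
pose H x :=
  \sum_(e : events s | inputs_of e == x) (\prod_(p in T) f p (e p)) * P e.
pose W (x : inputs s) := \prod_(p | (p \notin T) && (p != b)) w p (x p).
pose upd (x : inputs s) (y : input (pcard b)) : inputs s :=
  [ffun p => dfwith x y p].
have updb x y : upd x y b = y by rewrite ffunE dfwith_in.
have updN x y p : p != b -> upd x y p = x p.
  by move=> pb; rewrite ffunE dfwith_out // eq_sym.
have Tb p : p \in T -> p != b by apply: contraTneq => ->.
(* Only the input of [b] changes and [b] is outside [T], so the range of [t] is the same and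
   nonsignaling from [b] to [T] equates the inner sums. *)
have Hupd x y : H (upd x y) = H x.
  rewrite /H !sum_by_target; apply: eq_big => [t|t /forallP tP].
    by apply: eq_forallb => p; case: ifP => // pT; rewrite updN ?Tb.
  congr (_ * _); apply: (nsP [set b] T) => [||p|p pT].
  - by rewrite disjoints1.
  - by move=> p q /set1P ->; apply: bq.
  - by rewrite inE; apply: updN.
  - by have := tP p; rewrite pT => /eqP.
have Wupd x y : W (upd x y) = W x.
  by apply: eq_bigr => p /andP[_ pb]; rewrite updN.
(* At fixed inputs the factors outside [T] are constant and leave the sum over outputs. *)
have -> : \sum_(e : events s) (\prod_p f p (e p)) * P e
    = \sum_(x : inputs s) w b (x b) * (W x * H x).
  rewrite (partition_big (@inputs_of s) xpredT) //=; apply: eq_bigr => x _.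
  rewrite !mulr_sumr; apply: eq_bigr => e /eqP <-.
  rewrite (bigID (mem T)) /= [X in _ * X * _](bigD1 b) //= !mulrA.
  congr (_ * _).
  rewrite -mulrA mulrC ffunE fw //; congr (_ * _ * _).
  by apply: eq_bigr => p /andP[pT _]; rewrite ffunE fw.
(* Multiplying by the nonzero number of inputs of [b] introduces an independent second input of [b]
   to sum over. *)
apply: (mulfI (nin_neq0 R (pcard b))); rewrite mulr0.
pose F (z : inputs s * input (pcard b)) := w b (z.1 b) * (W z.1 * H z.1).
transitivity (\sum_z F z).
  rewrite -(pair_big xpredT xpredT (fun x y => F (x, y))) /= mulr_sumr.
  by apply: eq_bigr => x _; rewrite /F /= sumr_const card_ord mulr_natl.
(* Exchanging the input of b with an independent one frees the weight of b
   from the rest of the summand. *)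
pose swap (z : inputs s * input (pcard b)) := (upd z.1 z.2, z.1 b).
have swapK : involutive swap.
  case=> x y; rewrite /swap /= updb; congr (_, _); apply/ffunP => p.
  by have [->|pb] := eqVneq p b; rewrite ?updb ?updN.
rewrite (reindex_inj (inv_inj swapK)).
rewrite -(pair_big xpredT xpredT (fun x y => F (swap (x, y)))) /=.
rewrite big1 // => x _; rewrite /F /=.
under eq_bigr => y _ do rewrite updb Wupd Hupd.
by rewrite -mulr_suml wb mul0r.
Qed.

End Nonsignaling.

Arguments nonsignaling_sum_eq0 {R s P b T}.

(** * The forms and the component vanish on behaviors *)

Theorem proposition13 (R : realFieldType) (s : scenario)
    (r : {ffun party s -> sector})
    (hS : exists b, r b = Ssec)
    (hC : exists d, r d = Csec)
    (hE : forall b d : party s, r b = Ssec -> r d = Csec -> ~~ signals b d)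
    (P : tspace R s) (hP : behavior P) :
  (forall (l : inputs s) (kz : events s)
      (hl : forall b, r b = Ssec -> admissibleS (l b))
      (hkz : forall d, r d = Csec -> admissibleC (kz d)),
    tensor_form (fun p => match r p with
                          | Zsec => tau R (pcard p)
                          | Ssec => sigma_bar R (l p)
                          | Csec => gamma R (kz p)
                          end) P = 0)
  /\ component r P = 0.
Proof.
have [b rb] := hS; have [_ _ nsP] := hP; pose T := [set p | r p == Csec].
have bT : b \notin T by rewrite inE rb; apply/eqP.
have bq : {in T, forall q, ~~ signals b q}.
  by move=> q; rewrite inE => /eqP; apply: hE.
have notT p : p \notin T -> r p <> Csec by rewrite inE => /eqP.
split=> [l kz _ _|].
  (* These are the values of [tau] and [sigma_bar] on a basis vector with input [x]; the two deltas
     of an S-party cancel when summed over [x]. *)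
  pose w p (x : input (pcard p)) : R := match r p with
    | Zsec => (nin (pcard p))%:R^-1
    | _ => (nin (pcard p))%:R^-1 * ((x == l p)%:R - (x == last_in (pcard p))%:R)
    end.
  set form := (form in tensor_form form).
  rewrite tensor_formE.
  apply: (nonsignaling_sum_eq0 (fun p t => form p (basis R t)) w nsP bT bq).
    move=> p /notT; rewrite /form /w; case: (r p) => // _ e.
      exact: tau_basis.
    by rewrite sigma_barE !sigma_basis.
  rewrite /w rb -mulr_sumr sumrB.
  under eq_bigr do rewrite eq_sym.
  under [X in _ - X]eq_bigr do rewrite eq_sym.
  by rewrite !sum_input_delta subrr mulr0.
rewrite component_tensor_proj; apply/ffunP => e; rewrite tensor_projE ffunE.
(* Coordinate [e p] of the Z- or S-projection of a basis vector with input [x]. For an S-party, the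
   delta sums to 1 over [x], as does the constant subtracted from it. *)
pose w p (x : input (pcard p)) : R := match r p with
  | Zsec => (nin (pcard p))%:R^-1 / (nout (tag (e p)))%:R
  | _ => ((tag (e p) == x)%:R - (nin (pcard p))%:R^-1) / (nout (tag (e p)))%:R
  end.
apply: (nonsignaling_sum_eq0
  (fun p t => sector_proj (r p) (basis R t) (e p)) w nsP bT bq).
  move=> p /notT; rewrite /w; case: (r p) => // _ f;
    rewrite ffunE /= tau_basis //.
  by rewrite sigma_basis eq_sym.
rewrite /w rb -mulr_suml sumrB sum_input_delta sumr_const card_ord.
by rewrite -[_^-1 *+ _]mulr_natl divff ?nin_neq0 // subrr mul0r.
Qed.
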